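(* Let $n\ge 2$ be an integer and let $\Gamma_{Q_{4n}}$ be the non-commuting graph of the dicyclic group $Q_{4n}=\langle x,y : x^{2n}=y^4=1,\ x^n=y^2,\ y^{-1}xy=x^{-1}\rangle$ of order $4n$. Then: (a) $E(\Gamma_{Q_{4n}})\le LE^+(\Gamma_{Q_{4n}})\le LE(\Gamma_{Q_{4n}})$, and equality holds (in either inequality) if and only if $n=2$, i.e. the group is $Q_8$. (b) $\Gamma_{Q_{4n}}$ is neither hypoenergetic nor hyperenergetic. (c) $\Gamma_{Q_8}$ is neither L-hyperenergetic nor Q-hyperenergetic. If $n\ne 2$ then $\Gamma_{Q_{4n}}$ is both Q-hyperenergetic and L-hyperenergetic.
   Context: For a finite non-abelian group $G$ with center $Z(G)$, the non-commuting graph $\Gamma_G$ is the simple undirected graph with vertex set $G\setminus Z(G)$ in which $x,y$ are adjacent iff $xy\ne yx$. For a finite simple graph $\mathcal G$ with vertex set $v(\mathcal G)$, edge set $e(\mathcal G)$, adjacency matrix $A(\mathcal G)$ and diagonal degree matrix $D(\mathcal G)$, put $L(\mathcal G)=D(\mathcal G)-A(\mathcal G)$ (Laplacian) and $Q(\mathcal G)=D(\mathcal G)+A(\mathcal G)$ (signless Laplacian). With sums over eigenvalues counted with multiplicity, define $E(\mathcal G)=\sum_{\lambda}|\lambda|$ ($\lambda$ eigenvalues of $A(\mathcal G)$), $LE(\mathcal G)=\sum_{\beta}\left|\beta-\frac{2|e(\mathcal G)|}{|v(\mathcal G)|}\right|$ ($\beta$ eigenvalues of $L(\mathcal G)$),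 $LE^+(\mathcal G)=\sum_{\gamma}\left|\gamma-\frac{2|e(\mathcal G)|}{|v(\mathcal G)|}\right|$ ($\gamma$ eigenvalues of $Q(\mathcal G)$). With $K_n$ the complete graph on $n$ vertices, $\mathcal G$ is called hyperenergetic if $E(\mathcal G)>E(K_{|v(\mathcal G)|})$, hypoenergetic if $E(\mathcal G)<|v(\mathcal G)|$, L-hyperenergetic if $LE(\mathcal G)>LE(K_{|v(\mathcal G)|})$, and Q-hyperenergetic if $LE^+(\mathcal G)>LE^+(K_{|v(\mathcal G)|})$. *)

(* Defs.v *)
From HB Require Import structures.
From mathcomp Require Import all_boot all_order all_algebra all_fingroup all_solvable.

Set Implicit Arguments.
Unset Strict Implicit.
Unset Printing Implicit Defensive.

Import Order.TTheory GRing.Theory Num.Theory.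

Record sgraph := SGraph {
  vertex :> finType;
  adj : rel vertex;
  adj_sym : symmetric adj;
  adj_irrefl : irreflexive adj
}.

Definition edges (g : sgraph) : {set {set g}} :=
  [set [set p.1; p.2] | p : g * g & adj p.1 p.2].

Definition degree (g : sgraph) (x : g) : nat := #|[set y | adj x y]|.

Section CompleteGraph.
Variable n : nat.

Definition complete_adj : rel 'I_n := fun i j => i != j.

Lemma complete_adj_sym : symmetric complete_adj.
Proof. by move=> i j; rewrite /complete_adj eq_sym. Qed.

Lemma complete_adj_irrefl : irreflexive complete_adj.
Proof. by move=> i; rewrite /complete_adj eqxx. Qed.

Definition complete_graph : sgraph :=
  SGraph complete_adj_sym complete_adj_irrefl.
End CompleteGraph.

Section NonCommutingGraph.
Variables (gT : finGroupType) (G : {group gT}).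
Local Open Scope group_scope.

Definition noncentral : finType := {x : gT | x \in G :\: 'Z(G)}.

Definition nc_adj : rel noncentral :=
  fun x y => val x * val y != val y * val x.

Lemma nc_adj_sym : symmetric nc_adj.
Proof. by move=> x y; rewrite /nc_adj eq_sym. Qed.

Lemma nc_adj_irrefl : irreflexive nc_adj.
Proof. by move=> x; rewrite /nc_adj eqxx. Qed.

Definition noncommuting_graph : sgraph := SGraph nc_adj_sym nc_adj_irrefl.
End NonCommutingGraph.

(* [\isog Grp] tests homomorphisms to finite groups only; this determines G up
   to isomorphism since the group presented here is finite. In MathComp,
   [x ^ y] is the conjugate [y^-1 * x * y]. *)
Definition dicyclic (n : nat) (gT : finGroupType) (G : {group gT}) : Prop :=
  (G \isog Grp (x : y : x ^+ (2 * n) = y ^+ 4 = 1, x ^+ n = y ^+ 2,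
                        x ^ y = x^-1))%g.

Local Open Scope ring_scope.

Section Spectra.
Variable C : numClosedFieldType.

(* The eigenvalues with algebraic multiplicity, in an unspecified order:
   char_poly A = \prod_(z <- spectrum A) ('X - z%:P), as char_poly A is monic. *)
Definition spectrum (m : nat) (A : 'M[C]_m) : seq C :=
  sval (closed_field_poly_normal (char_poly A)).

Variable g : sgraph.

Definition adjacency_mx : 'M[C]_#|g| :=
  \matrix_(i, j) (adj (enum_val i : g) (enum_val j : g))%:R.

Definition degree_mx : 'M[C]_#|g| :=
  diag_mx (\row_i (degree (enum_val i : g))%:R).

Definition laplacian_mx : 'M[C]_#|g| := degree_mx - adjacency_mx.

Definition signless_laplacian_mx : 'M[C]_#|g| := degree_mx + adjacency_mx.

Definition average_degree : C := (2 * #|edges g|)%:R / #|g|%:R.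

Definition energy : C := \sum_(z <- spectrum adjacency_mx) `|z|.

Definition laplacian_energy : C :=
  \sum_(z <- spectrum laplacian_mx) `|z - average_degree|.

Definition signless_laplacian_energy : C :=
  \sum_(z <- spectrum signless_laplacian_mx) `|z - average_degree|.
End Spectra.

(* All energies are sums of norms, hence real elements of C, on which the
   partial order of C is total. *)
Definition hyperenergetic (C : numClosedFieldType) (g : sgraph) : Prop :=
  energy C g > energy C (complete_graph #|g|).

Definition hypoenergetic (C : numClosedFieldType) (g : sgraph) : Prop :=
  energy C g < #|g|%:R.

Definition L_hyperenergetic (C : numClosedFieldType) (g : sgraph) : Prop :=
  laplacian_energy C g > laplacian_energy C (complete_graph #|g|).

Definition Q_hyperenergetic (C : numClosedFieldType) (g : sgraph) : Prop :=
  signless_laplacian_energy C g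
    > signless_laplacian_energy C (complete_graph #|g|).

(* Main.v *)
(** Among the noncentral elements x^i y^b of Q_4n, commuting is an equivalence
    relation, with classes <x> \ {1, x^n} and {x^i y, x^(i+n) y} for i < n;
    hence the non-commuting graph is complete multipartite, with one part of
    size 2n - 2 and n parts of size 2.  Collapsing the parts, and then the n
    parts of equal size, reduces each characteristic polynomial to linear
    factors and one quadratic, which gives
      E   = 2(n-1) + 2 sqrt((n-1)(5n-1)),
      LE+ = 2s + (2n(n-2)(3n-4) + (n-1)|2n^2-10n+6|) / (2n-1),
      LE  = 4n(2(n-1)^2+1) / (2n-1),     where s = sqrt(8(n-1)^2+1).
    The comparisons follow from sqrt((n-1)(5n-1)) <= s <= 3(n-1) and
    2s >= 5(n-1). *)

Require Import Defs.
From HB Require Import structures.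
From mathcomp Require Import all_boot all_order all_algebra all_fingroup all_solvable.
From mathcomp Require Import ring zify.
Import Order.TTheory GRing.Theory Num.Theory.
Local Open Scope ring_scope.

(** * Determinants and characteristic polynomials of matrices constant on classes *)

Lemma sum_pick {R : pzSemiRingType} (I : finType) (i0 : I) (F : I -> R) :
  \sum_i (i0 == i)%:R * F i = F i0.
Proof.
by rewrite (bigD1 i0) //= eqxx mul1r big1 ?addr0 // => i; rewrite eq_sym =>
  /negPf ->; rewrite mul0r.
Qed.

(* Compare the two Schur complements of [[D, U], [-B U^T, 1]], where U is the indicator
   matrix of the classes, combined with D U = U diag(d). *)
Lemma det_classes {R : comNzRingType} {m k : nat} (c : 'I_m -> 'I_k)
    (d : 'I_k -> R) (B : 'I_k -> 'I_k -> R) :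
  \det (\matrix_(i < m, j < m) (d (c i) *+ (i == j) + B (c i) (c j)))
    * \prod_a d a
  = \prod_i d (c i)
    * \det (\matrix_(a < k, b < k)
              (d a *+ (a == b) + B a b * #|[set i | c i == b]|%:R)).
Proof.
set M := \matrix_(i, j) _; set N := \matrix_(a, b) _.
pose U : 'M[R]_(m, k) := \matrix_(i, a) (c i == a)%:R.
pose D : 'M[R]_m := diag_mx (\row_i d (c i)).
pose Dk : 'M[R]_k := diag_mx (\row_a d a).
pose Bk : 'M[R]_k := \matrix_(a, b) B a b.
have UBE i (b : 'I_k) : (U *m Bk) i b = B (c i) b.
  by rewrite mxE; under eq_bigr do rewrite !mxE; rewrite sum_pick.
have defM : M = D + U *m Bk *m U^T.
  apply/matrixP=> i j; rewrite !mxE; congr (_ + _).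
  by under eq_bigr do rewrite UBE !mxE mulrC; rewrite sum_pick.
have defN : N = Dk + Bk *m (U^T *m U).
  apply/matrixP=> a b; rewrite !mxE; congr (_ + _).
  have UU e : (U^T *m U) e b = (b == e)%:R * #|[set i | c i == b]|%:R.
    rewrite mxE -sum1_card natr_sum mulr_sumr [RHS]big_mkcond /=; apply: eq_bigr => i _.
    by rewrite !mxE inE; have [->|_] := eqVneq (c i) b; rewrite ?mulr1 ?mulr0.
  by under eq_bigr do rewrite UU mulrCA mxE; rewrite sum_pick.
have DU : D *m U = U *m Dk.
  rewrite mul_diag_mx mul_mx_diag; apply/matrixP=> i a; rewrite !mxE.
  by have [->|] := eqVneq (c i) a; rewrite ?mulr0 ?mul0r // mulrC.
pose S := block_mx D U (- (Bk *m U^T)) 1%:M.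
have S1 : S *m block_mx 1%:M 0 (Bk *m U^T) 1%:M = block_mx M U 0 1%:M.
  by rewrite mulmx_block !mulmx1 !mul1mx !mulmx0 !add0r addNr mulmxA -defM.
have S2 : S *m block_mx 1%:M (- U) 0 Dk = block_mx D 0 (- (Bk *m U^T)) N.
  rewrite mulmx_block !mulmx1 !mul1mx !mulmx0 !addr0 mulmxN DU addNr.
  by rewrite mulNmx mulmxN opprK addrC -mulmxA -defN.
(* The right factor in [S1] has determinant 1 and the one in [S2] has determinant [\prod_a d a].
   Nothing is divided by the [d a], so any commutative ring will do. *)
have := congr1 determinant S1; rewrite det_mulmx det_lblock det_ublock.
rewrite !det1 !mulr1 => <-; have := congr1 determinant S2.
rewrite det_mulmx det_lblock det_ublock det1 mul1r !det_diag.
by under eq_bigr do rewrite mxE; under [X in _ = X * _]eq_bigr do rewrite mxE.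
Qed.

Lemma prod_ord0_if {R : comPzSemiRingType} (q : nat) (x y : R) :
  \prod_(a < q.+1) (if a == ord0 then x else y) = x * y ^+ q.
Proof.
by rewrite big_ord_recl eqxx (eq_bigr (fun=> y)) // prodr_const card_ord.
Qed.

Lemma prod_classes {R : comPzSemiRingType} {I : finType} {q k l : nat}
    (c : I -> 'I_q.+1) (x y : R) :
    (forall a, #|[set i | c i == a]| = if a == ord0 then k else l) ->
  \prod_i (if c i == ord0 then x else y) = x ^+ k * y ^+ (q * l).
Proof.
move=> cardc; rewrite mulnC exprM -prod_ord0_if (partition_big c xpredT) //=.
apply: eq_bigr => a _; rewrite (eq_bigr (fun=> if a == ord0 then x else y)).
  rewrite prodr_const; have := cardc a; rewrite cardsE => ->.
  by case: (a == ord0).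
by move=> i /eqP->.
Qed.

Lemma det_mx22 {R : comNzRingType} (f : 'I_2 -> 'I_2 -> R) :
  \det (\matrix_(i, j) f i j)
  = f ord0 ord0 * f ord_max ord_max - f ord0 ord_max * f ord_max ord0.
Proof.
rewrite (expand_det_row _ ord0) big_ord_recl big_ord1 /cofactor !det_mx11 !mxE /=.
rewrite !expr0 expr1 mul1r mulN1r mulrN.
by congr (f _ _ * f _ _ - f _ _ * f _ _); apply/val_inj.
Qed.

(** The parameters cover three matrices at once: [e = 1] with zero diagonal is the adjacency matrix,
    while [e = -1] and [e = 1] with the degrees on the diagonal are the Laplacian and the signless
    Laplacian. [det_classes] is applied twice, from vertices to parts and then from parts to the two
    classes {[ord0]} and the rest. *)
Lemma char_poly_multipartite {F : fieldType} {m q p b : nat}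
    (c : 'I_m -> 'I_q.+1) (dx dy e : F) :
  (0 < p)%N -> (0 < b)%N -> (0 < q)%N ->
  (forall a : 'I_q.+1, #|[set i | c i == a]| = if a == ord0 then p else b) ->
  char_poly (\matrix_(i, j) ((if c i == ord0 then dx else dy) *+ (i == j)
                             + e * (c i != c j)%:R))
  = ('X - dx%:P) ^+ p.-1 * ('X - dy%:P) ^+ (q * b.-1)
    * ('X - (dy - b%:R * e)%:P) ^+ q.-1
    * (('X - dx%:P) * ('X - (dy + (q.-1 * b)%:R * e)%:P)
       - ((p * q * b)%:R * e ^+ 2)%:P).
Proof.
move=> p0 b0 q0 cardc.
pose size_ (a : 'I_q.+1) : nat := if a == ord0 then p else b.
pose del (a : 'I_q.+1) : {poly F} := if a == ord0 then 'X - dx%:P else 'X - dy%:P.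
pose B (a a' : 'I_q.+1) : {poly F} := - (e * (a != a')%:R)%:P.
have := det_classes c del B; rewrite (prod_classes _ _ _ cardc) prod_ord0_if.
(* Adding and subtracting [e] times the part size on the diagonal makes the non-diagonal term depend
   on the column alone, and only through its size; this allows the second collapse. *)
rewrite [X in _ = _ * \det X -> _](_ : _ = \matrix_(a, a')
  ((del a + e%:P * (size_ a)%:R) *+ (a == a') + - e%:P * (size_ a')%:R)); last first.
  apply/matrixP=> a a'; rewrite !mxE cardc /B -/(size_ a').
  have [->|ne] := eqVneq a a'; rewrite ?mulr0 ?mulr1 ?mulr1n ?mulr0n.
    by rewrite oppr0 mul0r addr0 mulNr addrK.
  by rewrite !add0r.
pose c2 (a : 'I_q.+1) : 'I_2 := if a == ord0 then ord0 else ord_max.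
have c2E a : (c2 a == ord0) = (a == ord0) by rewrite /c2; case: (a == ord0).
have cardc2 a2 : #|[set a | c2 a == a2]| = if a2 == ord0 then 1%N else q.
  have card0 : #|[set a | c2 a == ord0]| = 1%N.
    by rewrite -[RHS](cards1 (@ord0 q)); apply: eq_card => a; rewrite !inE c2E.
  have [->|/negPf ne] := eqVneq a2 ord0; first by [].
  have -> : [set a | c2 a == a2] = ~: [set a | c2 a == ord0].
    by apply/setP=> a; rewrite !inE; move: (c2 a) a2 ne => [[|[|?]] ?] [[|[|?]] ?].
  by apply/eqP; rewrite -(eqn_add2l 1) -{1}card0 cardsC card_ord.
set u := 'X - dx%:P + e%:P * p%:R; set v := 'X - dy%:P + e%:P * b%:R.
pose del2 (a : 'I_2) := if a == ord0 then u else v.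
pose size2 (a : 'I_2) : nat := if a == ord0 then p else b.
have := det_classes c2 del2 (fun _ a => - e%:P * (size2 a)%:R).
rewrite (prod_classes _ _ _ cardc2) prod_ord0_if !expr1 mul1n det_mx22 /=.
rewrite !cardc2 /del2 /size2 /=.
rewrite [X in \det X * (u * v)](_ : _ = \matrix_(a, a')
  ((del a + e%:P * (size_ a)%:R) *+ (a == a') + - e%:P * (size_ a')%:R)); last first.
  apply/matrixP=> a a'; rewrite !mxE !c2E /u /v /size_ /del.
  by case: (a == ord0).
have -> : char_poly (\matrix_(i, j) ((if c i == ord0 then dx else dy) *+ (i == j)
                                      + e * (c i != c j)%:R))
        = \det (\matrix_(i, j) (del (c i) *+ (i == j) + B (c i) (c j))).
  congr determinant; apply/matrixP=> i j; rewrite !mxE polyCD opprD addrA.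
  by congr (_ + _); rewrite polyCMn -mulrnBl /del; case: (c i == ord0).
(* Both uses of [det_classes] leave extra factors on the left. They are monic linear polynomials,
   hence can be cancelled. *)
have nz (z : F) : 'X - z%:P != 0 by rewrite monic_neq0 ?monicXsubC.
have u_nz : u != 0.
  move: (nz (dx - e * p%:R)).
  by rewrite polyCB opprB addrA /u addrAC polyCM -polyC_natr.
have v_nz : v != 0.
  move: (nz (dy - e * b%:R)).
  by rewrite polyCB opprB addrA /v addrAC polyCM -polyC_natr.
set N := \det _; set M := \det _ => defN defM.
have {}defN : N = v ^+ q.-1 * (('X - dx%:P) * ('X - (dy + (q.-1 * b)%:R * e)%:P)
       - ((p * q * b)%:R * e ^+ 2)%:P).
  apply: (mulIf (mulf_neq0 u_nz v_nz)); rewrite defN -(prednK q0) exprS /u /v.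
  rewrite !natrM -!natr1 /= !(polyCD, polyCM, polyCN, polyC_exp, polyC_natr).
  ring.
apply: (mulIf (mulf_neq0 (nz dx) (expf_neq0 q (nz dy)))).
rewrite defM defN -{1}(prednK p0) -{1}(prednK b0) mulnS exprD exprS.
have -> : 'X - (dy - b%:R * e)%:P = v.
  by rewrite polyCB opprB addrA /v addrAC polyCM polyC_natr [_ * b%:R]mulrC.
ring.
Qed.

(** * Spectra and energies of complete multipartite graphs with parts p, b, ..., b *)

(** Factorization into monic linear factors is unique up to order, and the sum ignores the order. *)
Lemma sum_spectrum {C : numClosedFieldType} {m : nat} (A : 'M[C]_m) (s : seq C)
    (F : C -> C) :
    char_poly A = \prod_(z <- s) ('X - z%:P) ->
  \sum_(z <- spectrum A) F z = \sum_(z <- s) F z.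
Proof.
move=> defA; apply/perm_big/prod_XsubC_eq; rewrite -defA /spectrum.
case: closed_field_poly_normal => r /= ->.
by rewrite (monicP (char_poly_monic A)) scale1r.
Qed.

(* The map [c] sends each vertex to its part. *)
Definition multipartite (p q b : nat) (g : sgraph) (c : g -> 'I_q.+1) : Prop :=
  (forall a : 'I_q.+1, #|[set u | c u == a]| = if a == ord0 then p else b)
  /\ (forall u v, adj u v = (c u != c v)).
Arguments multipartite : clear implicits.

(** With singleton parts, the energies of complete graphs become instances of the multipartite
    formulas. *)
Lemma complete_graph_multipartite (q : nat) :
  multipartite 1 q 1 (complete_graph q.+1) id.
Proof.
split=> [a|//]; rewrite if_same -[RHS](cards1 a); apply: eq_card => u.
by rewrite !inE.
Qed.

(** Double counting of the ordered adjacent pairs: grouped by first component they give the degrees,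
    and grouped by underlying edge they come in twos. *)
Lemma handshake (g : sgraph) : (2 * #|edges g| = \sum_u degree (u : g))%N.
Proof.
transitivity #|[set p : g * g | adj p.1 p.2]|; last first.
  rewrite -sum1dep_card -(pair_big_dep xpredT (fun u v => adj u v) (fun _ _ => 1%N)) /=.
  by apply: eq_bigr => u _; rewrite sum1dep_card.
rewrite -[RHS]sum1_card [RHS](partition_big_imset (fun p : g * g => [set p.1; p.2])) /=.
rewrite mulnC -sum_nat_const; apply: eq_big => [e|_ /imsetP[[u v] /= uv ->]].
  by apply/imsetP/imsetP=> -[p up ->]; exists p; rewrite ?inE // in up *.
have ne : u != v by apply: contraTneq uv => ->; rewrite inE adj_irrefl.
have ne2 : (u, v) != (v, u) by rewrite xpair_eqE negb_and ne.
(* The fibre over the edge {u, v} is {(u, v), (v, u)}. *)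
rewrite sum1dep_card; have := cards2 (u, v) (v, u); rewrite ne2 => <-.
apply: eq_card => -[a b]; rewrite !inE /= !xpair_eqE.
apply/orP/andP => [|[ab /eqP/setP eab]].
  rewrite inE /= in uv.
  by case=> /andP[/eqP-> /eqP->]; rewrite ?[[set v; u]]setUC eqxx // adj_sym.
have nab : a != b by apply: contraTneq ab => ->; rewrite adj_irrefl.
have := eab a; have := eab b; rewrite !inE !eqxx orbT /=.
move=> /esym/orP[]/eqP eb /esym/orP[]/eqP ea; move: nab; rewrite ea eb ?eqxx //.
  by right.
by left.
Qed.

Lemma card_multipartite (p q b : nat) (g : sgraph) c :
  multipartite p q b g c -> #|g| = (p + q * b)%N.
Proof.
case=> cardc _; rewrite -sum1_card (partition_big c xpredT) //=.
rewrite big_ord_recl sum1dep_card cardc eqxx; congr addn.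
rewrite (eq_bigr (fun=> b)) ?sum_nat_const ?card_ord // => a _.
by rewrite sum1dep_card cardc.
Qed.

Lemma degree_multipartite (p q b : nat) (g : sgraph) c (u : g) :
  (0 < q)%N -> multipartite p q b g c ->
  degree u = if c u == ord0 then (q * b)%N else (p + q.-1 * b)%N.
Proof.
move=> q0 gm; have [cardc adjE] := gm; have := card_multipartite _ _ _ _ _ gm.
have -> : degree u = #|~: [set v | c v == c u]|.
  by apply: eq_card => v; rewrite !inE adjE eq_sym.
rewrite -(cardsC [set v | c v == c u]) cardc.
case: eqP => _ /eqP; first by rewrite eqn_add2l => /eqP.
have -> : (p + q * b = b + (p + q.-1 * b))%N.
  by rewrite addnCA -mulSn prednK.
by rewrite eqn_add2l => /eqP.
Qed.

Lemma edges_multipartite (p q b : nat) (g : sgraph) c :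
  (0 < q)%N -> multipartite p q b g c ->
  (2 * #|edges g| = p * (q * b) + q * b * (p + q.-1 * b))%N.
Proof.
move=> q0 gm; have [cardc _] := gm; rewrite handshake (partition_big c xpredT) //=.
have deg a : (\sum_(u | c u == a) degree u
   = if a == ord0 then p * (q * b) else b * (p + q.-1 * b))%N.
  have := cardc a; rewrite cardsE => card_a.
  rewrite (eq_bigr (fun=> if a == ord0 then q * b else p + q.-1 * b)%N).
    by rewrite sum_nat_const card_a; case: (a == ord0).
  by move=> u /eqP <-; apply: degree_multipartite.
rewrite (eq_bigr _ (fun a _ => deg a)) big_ord_recl eqxx; congr addn.
by rewrite sum_nat_const card_ord mulnA.
Qed.

(** The roots of the quadratic factor enter through their sum and product, so each caller supplies
    them in a convenient form and no square root appears here. *)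
Lemma sum_spectrum_multipartite {C : numClosedFieldType} (p q b : nat)
    (g : sgraph) c (dx dy e z1 z2 : C) (A : 'M[C]_#|g|) (F : C -> C) :
    (0 < p)%N -> (0 < b)%N -> (0 < q)%N -> multipartite p q b g c ->
    (forall i j, A i j = (if c (enum_val i) == ord0 then dx else dy) *+ (i == j)
       + e * (adj (enum_val i) (enum_val j))%:R) ->
    z1 + z2 = dx + dy + (q.-1 * b)%:R * e ->
    z1 * z2 = dx * (dy + (q.-1 * b)%:R * e) - (p * q * b)%:R * e ^+ 2 ->
  \sum_(z <- spectrum A) F z
  = F dx *+ p.-1 + F dy *+ (q * b.-1) + F (dy - b%:R * e) *+ q.-1
    + (F z1 + F z2).
Proof.
move=> p0 b0 q0 [cardc adjE] defA zD zM.
pose s := nseq p.-1 dx ++ nseq (q * b.-1) dy ++ nseq q.-1 (dy - b%:R * e) ++ [:: z1; z2].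
rewrite (sum_spectrum _ s); last first.
  rewrite !big_cat !big_nseq big_cons big_seq1 !iter_mulr_1.
  have cardc' a : #|[set i : 'I_#|g| | c (enum_val i) == a]| = if a == ord0 then p else b.
    rewrite -cardc -!sum1dep_card (reindex (fun i : 'I_#|g| => enum_val i)) //=.
    exact/onW_bij/enum_val_bij.
  have -> : A = \matrix_(i, j) ((if c (enum_val i) == ord0 then dx else dy) *+ (i == j)
     + e * (c (enum_val i) != c (enum_val j))%:R).
    by apply/matrixP=> i j; rewrite mxE defA adjE.
  rewrite (char_poly_multipartite (fun i => c (enum_val i)) _ _ _ p0 b0 q0 cardc').
  rewrite /= -!mulrA; do 3!congr (_ * _).
  have -> : ('X - z1%:P) * ('X - z2%:P) = 'X ^+ 2 - (z1 + z2)%:P * 'X + (z1 * z2)%:P.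
    by rewrite !(polyCD, polyCM); ring.
  rewrite zD zM !(polyCD, polyCM, polyCN); ring.
by rewrite !big_cat !big_nseq big_cons big_seq1 !iter_addr_0 /= !addrA.
Qed.

Lemma degree_mx_multipartite {C : numClosedFieldType} {p q b : nat} {g : sgraph}
    {c : g -> 'I_q.+1} (i j : 'I_#|g|) :
  (0 < q)%N -> multipartite p q b g c ->
  degree_mx C g i j = (if c (enum_val i) == ord0 then (q * b)%:R
                       else (p + q.-1 * b)%:R) *+ (i == j).
Proof.
move=> q0 gm; rewrite !mxE (degree_multipartite _ _ _ _ _ _ q0 gm).
by case: (_ == ord0).
Qed.

Lemma energy_multipartite {C : numClosedFieldType} (p q b : nat) (g : sgraph)
    (c : g -> 'I_q.+1) (z1 z2 : C) :
    (0 < p)%N -> (0 < b)%N -> (0 < q)%N -> multipartite p q b g c ->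
    z1 + z2 = (q.-1 * b)%:R -> z1 * z2 = - (p * q * b)%:R ->
  energy C g = (b * q.-1)%:R + (`|z1| + `|z2|).
Proof.
move=> p0 b0 q0 gm zD zM.
rewrite /energy (sum_spectrum_multipartite _ _ _ _ _ 0 0 1 z1 z2 _ _ p0 b0 q0 gm).
- by rewrite normr0 !mul0rn !add0r mulr1 normrN normr_nat -mulrnA.
- by move=> i j; rewrite mxE if_same mul0rn add0r mul1r.
- by rewrite zD !add0r mulr1.
- by rewrite zM mul0r expr1n mulr1 sub0r.
Qed.

(** For [e = -1] the quadratic has the roots p + qb and 0. The linear factor of multiplicity q - 1
    also has the root p + qb, whence the total multiplicity q. *)
Lemma laplacian_energy_multipartite {C : numClosedFieldType} (p q b : nat)
    (g : sgraph) (c : g -> 'I_q.+1) :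
    (0 < p)%N -> (0 < b)%N -> (0 < q)%N -> multipartite p q b g c ->
  laplacian_energy C g
  = `|(q * b)%:R - average_degree C g| *+ p.-1
    + `|(p + q.-1 * b)%:R - average_degree C g| *+ (q * b.-1)
    + `|(p + q * b)%:R - average_degree C g| *+ q + `|average_degree C g|.
Proof.
move=> p0 b0 q0 gm; set avg := average_degree C g.
have qbE : (q * b = b + q.-1 * b)%N by rewrite -mulSn prednK.
rewrite /laplacian_energy (sum_spectrum_multipartite _ _ _ _ _
  (q * b)%:R (p + q.-1 * b)%:R (-1) (p + q * b)%:R 0 _ _ p0 b0 q0 gm).
- rewrite sub0r normrN addrA -[X in _ + X = _]/`|avg|; congr (_ + _).
  rewrite -addrA; congr (_ + _); rewrite mulrN1 opprK -natrD.
  have -> : (p + q.-1 * b + b = p + q * b)%N by rewrite qbE addnAC addnA.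
  by rewrite -mulrSr prednK.
- move=> i j; rewrite mxE (degree_mx_multipartite _ _ q0 gm) !mxE.
  by rewrite mulN1r.
- by rewrite qbE !natrD; ring.
- by rewrite natrD !natrM; ring.
Qed.

Lemma signless_laplacian_energy_multipartite {C : numClosedFieldType}
    (p q b : nat) (g : sgraph) (c : g -> 'I_q.+1) (z1 z2 : C) :
    (0 < p)%N -> (0 < b)%N -> (0 < q)%N -> multipartite p q b g c ->
    z1 + z2 = (p + q * b + 2 * (q.-1 * b))%:R ->
    z1 * z2 = (2 * (q * b) * (q.-1 * b))%:R ->
  signless_laplacian_energy C g
  = `|(q * b)%:R - average_degree C g| *+ p.-1
    + `|(p + q.-1 * b)%:R - average_degree C g| *+ (q * b.-1)
    + `|(p + q.-1 * b)%:R - b%:R - average_degree C g| *+ q.-1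
    + (`|z1 - average_degree C g| + `|z2 - average_degree C g|).
Proof.
move=> p0 b0 q0 gm zD zM; set avg := average_degree C g.
rewrite /signless_laplacian_energy (sum_spectrum_multipartite _ _ _ _ _
  (q * b)%:R (p + q.-1 * b)%:R 1 z1 z2 _ _ p0 b0 q0 gm).
- by rewrite mulr1.
- move=> i j; rewrite mxE (degree_mx_multipartite _ _ q0 gm) !mxE.
  by rewrite mul1r.
- by rewrite zD !natrD !natrM; ring.
- by rewrite zM !natrM !natrD !natrM; ring.
Qed.

Lemma average_degree_multipartite {C : numClosedFieldType} (p q b : nat)
    (g : sgraph) (c : g -> 'I_q.+1) :
  (0 < q)%N -> multipartite p q b g c ->
  average_degree C g
  = (p * (q * b) + q * b * (p + q.-1 * b))%:R / (p + q * b)%:R.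
Proof.
move=> q0 gm; rewrite /average_degree (edges_multipartite _ _ _ _ _ q0 gm).
by rewrite (card_multipartite _ _ _ _ _ gm).
Qed.

(** * Energies of complete graphs *)

Lemma energy_complete {C : numClosedFieldType} (q : nat) :
  (0 < q)%N -> energy C (complete_graph q.+1) = (2 * q)%:R.
Proof.
move=> q0; rewrite (energy_multipartite _ _ _ _ _ q%:R (-1) _ _ q0
  (complete_graph_multipartite q)) //.
- rewrite normrN normr1 normr_nat mul1n natr1 -natrD; congr _%:R; lia.
- by rewrite muln1 -subn1 natrB.
- by rewrite mul1n muln1 mulrN1.
Qed.

Lemma average_degree_complete {C : numClosedFieldType} (q : nat) :
  (0 < q)%N -> average_degree C (complete_graph q.+1) = q%:R.
Proof.
move=> q0; rewrite (average_degree_multipartite _ _ _ _ _ q0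
  (complete_graph_multipartite q)).
have -> : (1 * (q * 1) + q * 1 * (1 + q.-1 * 1) = q * (1 + q * 1))%N by nia.
by rewrite natrM mulfK // pnatr_eq0.
Qed.

Lemma laplacian_energy_complete {C : numClosedFieldType} (q : nat) :
  (0 < q)%N -> laplacian_energy C (complete_graph q.+1) = (2 * q)%:R.
Proof.
move=> q0; rewrite (laplacian_energy_multipartite _ _ _ _ _ _ _ q0
  (complete_graph_multipartite q)) // average_degree_complete //.
rewrite mulr0n muln0 mulr0n !add0r muln1 natrD addrK normr1 normr_nat -natrD.
congr _%:R; lia.
Qed.

Lemma signless_laplacian_energy_complete {C : numClosedFieldType} (q : nat) :
  (0 < q)%N -> signless_laplacian_energy C (complete_graph q.+1) = (2 * q)%:R.
Proof.
move=> q0; rewrite (signless_laplacian_energy_multipartite _ _ _ _ _ (2 * q)%:R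
  q.-1%:R _ _ q0 (complete_graph_multipartite q)) //.
- rewrite average_degree_complete // mulr0n muln0 mulr0n !add0r.
  rewrite muln1 add1n prednK // addrAC subrr sub0r normrN normr1.
  rewrite mul2n -addnn natrD addrK normr_nat distrC -natrB ?leq_pred // normr_nat.
  rewrite -!natrD; congr _%:R; lia.
- rewrite -natrD; congr _%:R; lia.
- rewrite -natrM; congr _%:R; lia.
Qed.

(** * Energies for the parts 2n - 2, 2, ..., 2, and their comparison *)

Lemma sqrtC_natr_le {C : numClosedFieldType} (m j : nat) :
  (sqrtC m%:R <= j%:R :> C) = (m <= j ^ 2)%N.
Proof.
by rewrite -(ler_sqr (x := sqrtC _)) ?nnegrE ?sqrtC_ge0 ?ler0n // sqrtCK -natrX ler_nat.
Qed.

Lemma sqrtC_natr_ge {C : numClosedFieldType} (m j : nat) :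
  (j%:R <= sqrtC m%:R :> C) = (j ^ 2 <= m)%N.
Proof.
by rewrite -(ler_sqr (y := sqrtC _)) ?nnegrE ?sqrtC_ge0 ?ler0n // sqrtCK -natrX ler_nat.
Qed.

Lemma sqrtC_natr_lt {C : numClosedFieldType} (m j : nat) :
  (sqrtC m%:R < j%:R :> C) = (m < j ^ 2)%N.
Proof.
by rewrite -(ltr_sqr (x := sqrtC _)) ?nnegrE ?sqrtC_ge0 ?ler0n // sqrtCK -natrX ltr_nat.
Qed.

(** Applied to the conjugate roots of the quadratic factor, shifted by the average degree in the
    signless case: they have opposite signs, so their midpoint t cancels. *)
Lemma norm_addr_subr {C : numDomainType} (t s : C) :
  0 <= t -> t <= s -> `|t + s| + `|t - s| = 2 * s.
Proof.
move=> t0 ts; rewrite distrC ger0_norm ?addr_ge0 ?(le_trans t0) //.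
by rewrite ger0_norm ?subr_ge0 //; ring.
Qed.

(** Gives the distance from an integer eigenvalue to the average degree c / w. The disjunction
    records on which side the eigenvalue lies, leaving only an identity of naturals to check. *)
Lemma norm_natr_sub_div {C : numFieldType} (a c d w : nat) :
    (0 < w)%N -> (a * w = c + d \/ a * w + d = c)%N ->
  `|a%:R - c%:R / w%:R| = d%:R / w%:R :> C.
Proof.
move=> w0 eq_ac; have wnz : w%:R != 0 :> C by rewrite pnatr_eq0 -lt0n.
rewrite -[a%:R](mulfK wnz) -mulrBl normrM normfV normr_nat -natrM.
case: eq_ac => [->|<-]; first by rewrite natrD addrC addKr normr_nat.
by rewrite natrD opprD addNKr normrN normr_nat.
Qed.

(* Below, n = k + 2, which avoids the subtractions n - 1 and 2n - 2. *)
Lemma energy_dicyclic {C : numClosedFieldType} (k : nat) (g : sgraph) c :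
    multipartite (2 * k.+1) k.+2 2 g c ->
  energy C g = (2 * k.+1)%:R + 2 * sqrtC (k.+1 * (5 * k + 9))%:R.
Proof.
move=> gm; set r := sqrtC _.
have r2 : r ^+ 2 = (k.+1 * (5 * k + 9))%:R by rewrite sqrtCK.
(* These are the roots of z^2 - 2(k+1)z - 4(k+1)(k+2); a quarter of its discriminant is
   (k+1)(5k+9). *)
rewrite (energy_multipartite _ _ _ _ _ (k.+1%:R + r) (k.+1%:R - r) _ _ _ gm) //.
- by rewrite norm_addr_subr // sqrtC_natr_ge; nia.
- by rewrite addrACA subrr addr0 -natrD; congr _%:R; lia.
- rewrite mulrC -subr_sqr r2 -natrX -opprB -natrB; last by nia.
  by congr (- _%:R); nia.
Qed.

Lemma average_degree_dicyclic {C : numClosedFieldType} (k : nat) (g : sgraph) c :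
    multipartite (2 * k.+1) k.+2 2 g c ->
  average_degree C g = (6 * k.+1 * k.+2)%:R / (2 * k + 3)%:R.
Proof.
move=> gm; rewrite (average_degree_multipartite _ _ _ _ _ _ gm) //=.
apply/eqP; rewrite eqr_div ?pnatr_eq0; try lia.
by rewrite -!natrM; apply/eqP; congr _%:R; nia.
Qed.

Lemma laplacian_energy_dicyclic {C : numClosedFieldType} (k : nat) (g : sgraph) c :
    multipartite (2 * k.+1) k.+2 2 g c ->
  laplacian_energy C g
  = (4 * k.+2 * (2 * k ^ 2 + 4 * k + 3))%:R / (2 * k + 3)%:R.
Proof.
move=> gm; rewrite (laplacian_energy_multipartite _ _ _ _ _ _ _ _ gm) //=.
rewrite (average_degree_dicyclic _ _ _ gm).
(* The eigenvalue 2n is at most the average degree, the next two are at least that; hence [right],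
   [left], [left]. *)
rewrite (norm_natr_sub_div (k.+2 * 2) _ (2 * k * k.+2)); [|lia|by right; nia].
rewrite (norm_natr_sub_div (2 * k.+1 + k.+1 * 2) _ (2 * k * k.+1)); [|lia|by left; nia].
rewrite (norm_natr_sub_div (2 * k.+1 + k.+2 * 2) _ (2 * k ^ 2 + 6 * k + 6));
  [|lia|by left; nia].
rewrite ger0_norm ?divr_ge0 ?ler0n // -!mulrnAl -!mulrDl -!mulrnA -!natrD.
by congr (_%:R / _); nia.
Qed.

(* The subtractions on naturals are truncated: exactly one of them is nonzero,
   and their sum is |2k^2 - 2k - 6|. *)
Definition signless_excess (k : nat) : nat :=
  (2 * k * k.+2 * (3 * k + 2)
  + k.+1 * ((2 * k ^ 2 - (2 * k + 6)) + (2 * k + 6 - 2 * k ^ 2)))%N.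

Lemma signless_laplacian_energy_dicyclic {C : numClosedFieldType} (k : nat)
    (g : sgraph) c :
    multipartite (2 * k.+1) k.+2 2 g c ->
  signless_laplacian_energy C g
  = 2 * sqrtC (8 * k.+1 ^ 2 + 1)%:R + (signless_excess k)%:R / (2 * k + 3)%:R.
Proof.
move=> gm; set s := sqrtC _.
have s2 : s ^+ 2 = (8 * k.+1 ^ 2 + 1)%:R by rewrite sqrtCK.
(* These are the roots of z^2 - 2(4k+5)z + 8(k+1)(k+2). *)
rewrite (signless_laplacian_energy_multipartite _ _ _ _ _ ((4 * k + 5)%:R + s)
  ((4 * k + 5)%:R - s) _ _ _ gm) //; last first.
- rewrite mulrC -subr_sqr s2 -natrX -natrB; last by nia.
  by congr (_%:R); nia.
- by rewrite addrACA subrr addr0 -natrD; congr _%:R; lia.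
rewrite (average_degree_dicyclic _ _ _ gm) /=.
rewrite -natrB; last by lia.
rewrite (norm_natr_sub_div (k.+2 * 2) _ (2 * k * k.+2)); [|lia|by right; nia].
rewrite (norm_natr_sub_div (2 * k.+1 + k.+1 * 2) _ (2 * k * k.+1)); [|lia|by left; nia].
(* The eigenvalue 4k + 2 is below the average degree for k <= 2 and above it from k = 3 on. *)
rewrite (norm_natr_sub_div (2 * k.+1 + k.+1 * 2 - 2) _
  ((2 * k ^ 2 - (2 * k + 6)) + (2 * k + 6 - 2 * k ^ 2))); [|lia|]; last first.
  by case: (leqP (2 * k + 6) (2 * k ^ 2)) => ?; [left|right]; nia.
(* The midpoint of the two roots, measured from the average degree. As 0 <= t <= 2(k+1) <= s, the
   two roots contribute exactly 2s. *)
set t : C := (4 * k + 5)%:R - (6 * k.+1 * k.+2)%:R / (2 * k + 3)%:R.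
have tE : t = (2 * k ^ 2 + 4 * k + 3)%:R / (2 * k + 3)%:R.
  have wnz : (2 * k + 3)%:R != 0 :> C by rewrite pnatr_eq0; lia.
  apply: (mulIf wnz); rewrite mulrBl !mulfVK // -natrM -natrB; last by nia.
  by congr _%:R; nia.
rewrite [_ + s - _]addrAC [_ - s - _]addrAC -/t norm_addr_subr; last first.
- apply: (le_trans (y := (2 * k.+1)%:R)); last by rewrite sqrtC_natr_ge; nia.
  rewrite tE ler_pdivrMr ?ltr0n; last by lia.
  by rewrite -natrM ler_nat; nia.
- by rewrite tE divr_ge0 ?ler0n.
rewrite addrC; congr (_ + _); rewrite -!mulrnAl -!mulrDl -!mulrnA -!natrD.
by rewrite /signless_excess; congr (_%:R / _); nia.
Qed.

(** For n = 2 both radicands are 9, and the formulas read 2 + 6, 6 + 6/3 and 24/3. *)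
Lemma energies_Q8 {C : numClosedFieldType} (g : sgraph) c :
    multipartite 2 2 2 g c ->
  [/\ energy C g = 8%:R, signless_laplacian_energy C g = 8%:R
    & laplacian_energy C g = 8%:R].
Proof.
move=> gm; have gm0 : multipartite (2 * 1) 2 2 g c by [].
have sqrt9 : sqrtC 9%:R = 3%:R :> C by rewrite (natrX _ 3 2) sqrCK ?ler0n.
have div3 m : (m * 3)%:R / 3%:R = m%:R :> C by rewrite natrM mulfK ?pnatr_eq0.
rewrite (energy_dicyclic _ _ _ gm0) (signless_laplacian_energy_dicyclic _ _ _ gm0).
rewrite (laplacian_energy_dicyclic _ _ _ gm0) /= -[(1 * (5 * 0 + 9))%N]/9%N.
rewrite -[(8 * 1 ^ 2 + 1)%N]/9%N -[(2 * 0 + 3)%N]/3%N sqrt9.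
rewrite -[signless_excess 0]/(2 * 3)%N -[(4 * 2 * _)%N]/(8 * 3)%N !div3.
by split; rewrite -?natrM -?natrD.
Qed.

(** The square roots and the rational parts are compared separately. Both comparisons are equalities
    at k = 0, and the rational one is strict for k > 0. *)
Lemma energy_lt_signless {C : numClosedFieldType} (k : nat) (g : sgraph) c :
    (0 < k)%N -> multipartite (2 * k.+1) k.+2 2 g c ->
  energy C g < signless_laplacian_energy C g.
Proof.
move=> k0 gm; rewrite (energy_dicyclic _ _ _ gm) addrC.
rewrite (signless_laplacian_energy_dicyclic _ _ _ gm).
apply: ler_ltD.
  by rewrite ler_pM2l ?ltr0n // ler_sqrtC ?nnegrE ?ler0n // ler_nat; nia.
rewrite ltr_pdivlMr ?ltr0n; last by lia.
by rewrite -natrM ltr_nat /signless_excess; nia.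
Qed.

Lemma signless_lt_laplacian {C : numClosedFieldType} (k : nat) (g : sgraph) c :
    (0 < k)%N -> multipartite (2 * k.+1) k.+2 2 g c ->
  signless_laplacian_energy C g < laplacian_energy C g.
Proof.
move=> k0 gm; rewrite (signless_laplacian_energy_dicyclic _ _ _ gm).
rewrite (laplacian_energy_dicyclic _ _ _ gm) -ltrBrDr -mulrBl.
have w0 : 0 < (2 * k + 3)%:R :> C by rewrite ltr0n; lia.
(* The bound s < 3(k+1) amounts to 1 < (k+1)^2; this is where k > 0 makes the inequality strict. *)
apply: (lt_le_trans (y := 2 * (3 * k.+1)%:R)).
  by rewrite ltr_pM2l ?ltr0n // sqrtC_natr_lt; nia.
rewrite ler_pdivlMr // lerBrDr -!natrM -natrD ler_nat /signless_excess.
by case: (leqP (2 * k + 6) (2 * k ^ 2)) => ?; nia.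
Qed.

(** The bound is the energy, of each of the three kinds, of the complete graph on the 4k + 6
    vertices of [g]. *)
Lemma signless_gt_complete {C : numClosedFieldType} (k : nat) (g : sgraph) c :
    (0 < k)%N -> multipartite (2 * k.+1) k.+2 2 g c ->
  (2 * (4 * k + 5))%:R < signless_laplacian_energy C g.
Proof.
move=> k0 gm; rewrite (signless_laplacian_energy_dicyclic _ _ _ gm).
have w0 : 0 < (2 * k + 3)%:R :> C by rewrite ltr0n; lia.
apply: (lt_le_trans (y := (5 * k.+1)%:R + (signless_excess k)%:R / (2 * k + 3)%:R)).
  rewrite -ltrBlDl ltr_pdivlMr // mulrBl ltrBlDl -!natrM -natrD ltr_nat.
  (* The margin is narrow at k = 1, where the claim reads 90 < 92 and is decided by computation. *)
  by rewrite /signless_excess; have [->|k1] := eqVneq k 1%N; [|nia].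
rewrite lerD2r -ler_pdivrMl ?ltr0n //.
rewrite -(ler_sqr (y := sqrtC _)) ?nnegrE ?sqrtC_ge0 ?mulr_ge0 ?invr_ge0 ?ler0n //.
rewrite sqrtCK exprMn exprVn ler_pdivrMl ?exprn_gt0 ?ltr0n //.
by rewrite -!natrX -natrM ler_nat; nia.
Qed.

Lemma energy_le_complete {C : numClosedFieldType} (k : nat) (g : sgraph) c :
    multipartite (2 * k.+1) k.+2 2 g c ->
  energy C g <= (2 * (4 * k + 5))%:R.
Proof.
move=> gm; rewrite (energy_dicyclic _ _ _ gm).
(* Splitting off the rational part of the energy leaves the bound 3k + 4 for the square root. *)
have -> : (2 * (4 * k + 5) = 2 * k.+1 + 2 * (3 * k + 4))%N by lia.
by rewrite natrD lerD2l (natrM _ 2) ler_pM2l ?ltr0n // sqrtC_natr_le; nia.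
Qed.

Lemma energy_ge_card {C : numClosedFieldType} (k : nat) (g : sgraph) c :
    multipartite (2 * k.+1) k.+2 2 g c -> #|g|%:R <= energy C g.
Proof.
move=> gm; rewrite (energy_dicyclic _ _ _ gm) (card_multipartite _ _ _ _ _ gm).
by rewrite natrD lerD2l mulnC (natrM _ 2) ler_pM2l ?ltr0n // sqrtC_natr_ge; nia.
Qed.

(** * The dicyclic group and the commuting classes of its noncentral elements *)

(* The right regular representation of the dicyclic group on normal forms:
   the pair (i, b) stands for x^i y^b. *)
Definition dicyclic_rotation (n : nat) (t : 'Z_(2 * n) * bool) : 'Z_(2 * n) * bool :=
  (if t.2 then t.1 - 1 else t.1 + 1, t.2).

Definition dicyclic_reflection (n : nat) (t : 'Z_(2 * n) * bool) : 'Z_(2 * n) * bool :=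
  (if t.2 then t.1 + n%:R else t.1, ~~ t.2).

Lemma dicyclic_rotation_inj (n : nat) : injective (dicyclic_rotation n).
Proof.
by move=> [i b] [j b'] [eq_ij /= eq_b]; case: b' eq_b eq_ij => -> /addIr->.
Qed.

Lemma dicyclic_reflection_inj (n : nat) : injective (dicyclic_reflection n).
Proof.
move=> [i b] [j b'] [eq_ij /= /negb_inj eq_b].
by case: b' eq_b eq_ij => -> => [/addIr->|->].
Qed.

(** The two permutations satisfy the defining relations, so the group they generate is a quotient of
    [G]; it has at least 4n elements. *)
Lemma dicyclic_card_ge {n : nat} {gT : finGroupType} {G : {group gT}} :
  (0 < n)%N -> dicyclic n G -> (4 * n <= #|G|)%N.
Proof.
move=> n0 dicG; pose X := perm (dicyclic_rotation_inj n).
pose Y := perm (dicyclic_reflection_inj n).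
have XE k i b : (X ^+ k)%g (i, b) = (if b then i - k%:R else i + k%:R, b).
  rewrite permX; elim: k => [|k IHk]; first by rewrite subr0 addr0; case: b.
  rewrite iterS {}IHk permE /dicyclic_rotation /=.
  by case: b; rewrite -natr1 ?opprD addrA.
have YE i b : Y (i, b) = (if b then i + n%:R else i, ~~ b) by rewrite permE.
(* ['Z_m] is the ring of integers modulo m only when 1 < m. *)
have n2 : (1 < 2 * n)%N by lia.
have nn : n%:R + n%:R = 0 :> 'Z_(2 * n) by rewrite -natrD addnn -mul2n pchar_Zp.
have nN : - n%:R = n%:R :> 'Z_(2 * n) by apply/eqP; rewrite eq_sym -addr_eq0 nn.
have homH : (<[X]> <*> <[Y]> \homg Grp (x : y : x ^+ (2 * n) = y ^+ 4 = 1,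
    x ^+ n = y ^+ 2, x ^ y = x^-1))%g.
  apply/existsP; exists (X, Y); rewrite /= !xpair_eqE eqxx /=.
  apply/and4P; split; apply/eqP.
  - by apply/permP=> -[i b]; rewrite XE pchar_Zp // subr0 addr0 perm1; case: b.
  - apply/permP=> -[i b]; rewrite permX perm1 /= !YE /=.
    by case: b; rewrite /= -addrA nn addr0.
  - apply/permP=> -[i b]; rewrite XE permX /= !YE /= nN.
    by case: b.
  (* The conjugation relation is checked in the inverse-free form X Y X = Y. *)
  apply: (mulgI Y); rewrite -conjgC; apply: (mulIg X); rewrite mulgKV.
  apply/permP=> -[i b]; rewrite !permM -(expg1 X) !XE !YE !XE.
  by case: b; rewrite /= ?addrK // addrAC subrK.
rewrite -dicG in homH; apply: leq_trans (leq_homg homH).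
pose f (t : 'Z_(2 * n) * bool) := (X ^+ t.1 * Y ^+ t.2)%g.
have f_inj : injective f.
  (* The image of (0, false), the identity, recovers (i, b) from X^i Y^b. *)
  apply: (can_inj (g := fun s : {perm _} => s (0, false))) => -[i b].
  rewrite /f permM XE add0r natr_Zp permX.
  by case: b => //=; rewrite YE.
have <- : #|f @: setT| = (4 * n)%N.
  by rewrite card_imset // cardsT card_prod card_bool card_ord Zp_cast //; lia.
apply/subset_leq_card/subsetP=> _ /imsetP[t _ ->].
by rewrite groupM // groupX // mem_gen // inE cycle_id ?orbT.
Qed.

(** The relations leave at most 4n products x^i y^b, and [G] has at least 4n elements, so these
    products are pairwise distinct. The exact order of x and y lying outside <x> follow. *)
Lemma dicyclic_normal_form {n : nat} {gT : finGroupType} {G : {group gT}} :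
  (0 < n)%N -> dicyclic n G ->
  exists x y : gT,
    [/\ x \in G /\ y \in G,
        {in G, forall g, exists i (b : bool), g = x ^+ i * y ^+ b}%g & [/\
        #[x]%g = (2 * n)%N, y \notin <[x]>%g, (x ^ y = x^-1)%g & (y ^+ 2 = x ^+ n)%g]].
Proof.
move=> n0 dicG; have := isoGrp_hom dicG.
case/existsP=> -[x y] /= /eqP[defG x2n y4 xn xy].
have ox : (#[x]%g %| 2 * n)%N by rewrite order_dvdn x2n.
pose f (t : 'I_(2 * n) * bool) := (x ^+ t.1 * y ^+ t.2)%g.
have fE (i : nat) (b : bool) : (x ^+ i * y ^+ b \in f @: setT)%g.
  have i_lt : (i %% (2 * n) < 2 * n)%N by rewrite ltn_mod; lia.
  apply/imsetP; exists (Ordinal i_lt, b); rewrite // /f /=.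
  by rewrite {1}(divn_eq i (2 * n)) expgD mulnC expgM x2n expg1n mul1g.
have nyx : (<[y]> \subset 'N(<[x]>))%g.
  by rewrite norms_cycle xy groupV cycle_id.
have sGf : G \subset f @: setT.
  rewrite -defG norm_joinEr //.
  apply/subsetP=> _ /mulsgP[_ _ /cycleP[i ->] /cycleP[j ->] ->].
  (* Even powers of y are absorbed into the power of x by y^2 = x^n. *)
  rewrite (divn_eq j 2) expgD mulnC expgM -xn -expgM mulgA -expgD modn2.
  exact: fE.
have card_dom : #|[set: 'I_(2 * n) * bool]| = (4 * n)%N.
  by rewrite cardsT card_prod card_bool card_ord; lia.
have [Gx Gy] : x \in G /\ y \in G.
  by rewrite -defG !mem_gen // inE cycle_id ?orbT.
have f_inj : injective f.
  move=> t1 t2.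
  have /imset_injP f_inj : #|f @: setT| == #|[set: 'I_(2 * n) * bool]|.
    rewrite eqn_leq leq_imset_card card_dom.
    by rewrite (leq_trans (dicyclic_card_ge n0 dicG)) // subset_leq_card.
  exact: f_inj (in_setT _) (in_setT _).
have lt0 : (0 < 2 * n)%N by lia.
exists x, y; split=> //; last split=> //.
- move=> g /(subsetP sGf)/imsetP[t _ ->]; by exists t.1, t.2.
- apply/eqP; rewrite eqn_leq dvdn_leq //= leqNgt; apply/negP=> ox_lt.
  have /f_inj[] : f (Ordinal ox_lt, false) = f (Ordinal lt0, false).
    by rewrite /f /= expg_order.
  by move=> ox0; have := order_gt0 x; rewrite ox0.
apply/negP=> /cycleP[i yE]; have i_lt : (i %% (2 * n) < 2 * n)%N by rewrite ltn_mod.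
have /f_inj[] // : f (Ordinal lt0, true) = f (Ordinal i_lt, false).
rewrite /f /= mul1g mulg1 expg1 yE {1}(divn_eq i (2 * n)) expgD mulnC expgM x2n.
by rewrite expg1n mul1g.
Qed.

Lemma card_noncentral_set {gT : finGroupType} (G : {group gT}) (P : pred gT) :
  #|[set u : noncentral G | P (val u)]| = #|[set g in G :\: 'Z(G)%g | P g]|.
Proof.
rewrite -(card_imset _ val_inj); apply: eq_card => g; rewrite inE.
apply/imsetP/andP=> [[u]|[Gg Pg]]; first by rewrite inE => Pu ->; rewrite (valP u).
by exists (Sub g Gg); rewrite ?inE ?SubK.
Qed.

Lemma dicyclic_multipartite {n : nat} {gT : finGroupType} {G : {group gT}} :
  (2 <= n)%N -> dicyclic n G ->
  exists c, multipartite (2 * n.-1) n 2 (noncommuting_graph G) c.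
Proof.
move=> n2 dicG; have n0 : (0 < n)%N by lia.
have [x [y [[Gx Gy] formG [ox xNy xy y2]]]] := dicyclic_normal_form n0 dicG.
have eqx i j : (x ^+ i == x ^+ j)%g = (i == j %[mod 2 * n]).
  by rewrite eq_expg_mod_order ox.
have xiy i : (x ^+ i * y = y * x ^- i)%g by rewrite conjgC conjXg xy expgVn.
have yxi i : (y * x ^+ i = x ^- i * y)%g.
  by apply: (mulgI (x ^+ i)%g); rewrite mulgA xiy mulgKV mulKVg.
have xi_ne i j : (x ^+ i != x ^+ j * y)%g.
  apply: contra xNy => /eqP xiE; rewrite -(groupMl _ (mem_cycle x j)) -xiE.
  exact: mem_cycle.
have double_mod i j : (i + i == j + j %[mod 2 * n]) = (i == j %[mod n]).
  by rewrite !addnn -!mul2n -!muln_modr ?eqn_pmul2l.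
(* Moving y to the right turns the equation into x^(2i) = 1; likewise [comm_yy] amounts to x^(2i) =
   x^(2j). *)
have comm_xy i j : (x ^+ i * (x ^+ j * y) == x ^+ j * y * x ^+ i)%g = (n %| i)%N.
  rewrite -(mulgA _ y) yxi !mulgA (inj_eq (mulIg y)).
  rewrite -(inj_eq (mulIg (x ^+ i)%g)) mulgKV -!expgD addnAC -{2}[j]add0n eqx.
  by rewrite eqn_modDr -[0%N]/(0 + 0)%N double_mod mod0n.
have comm_yy i j :
    (x ^+ i * y * (x ^+ j * y) == x ^+ j * y * (x ^+ i * y))%g = (i == j %[mod n]).
  have yy k l : (x ^+ k * y * (x ^+ l * y) = x ^+ k * x ^- l * y * y)%g.
    by rewrite mulgA -(mulgA _ y) yxi !mulgA.
  rewrite !yy !(inj_eq (mulIg y)) -(inj_eq (mulIg (x ^+ (j + i))%g)) {2}addnC !expgD.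
  by rewrite !mulgA !mulgKV -!expgD eqx double_mod.
have commX i j : (x ^+ i * x ^+ j = x ^+ j * x ^+ i)%g by rewrite -!expgD addnC.
have memZ i : (x ^+ i \in 'Z(G))%g = (n %| i)%N.
  apply/centerP/idP=> [[_ /(_ (x ^+ 0 * y)%g)]|ni].
    by rewrite mul1g => /(_ Gy)/eqP; rewrite -{1 2}[y]mul1g (comm_xy i 0).
  split=> [|g Gg]; first exact: groupX.
  have [j [[] ->]] := formG g Gg; last by rewrite mulg1; apply: commX.
  by apply/eqP; rewrite expg1 comm_xy.
(* Commuting with x would force n to divide 1, against n >= 2. *)
have NmemZ i : (x ^+ i * y)%g \notin 'Z(G)%g.
  apply/negP=> /centerP[_ /(_ x Gx)/esym/eqP]; rewrite -{1 3}[x]expg1 comm_xy dvdn1.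
  lia.
have noncentralP g : g \in G :\: 'Z(G)%g ->
    exists i, (g = x ^+ i)%g /\ ~~ (n %| i)%N \/ (g = x ^+ i * y)%g.
  rewrite inE => /andP[nZg /formG[i [[] gE]]]; exists i; [right|left].
    by rewrite gE.
  by rewrite -memZ gE mulg1 in nZg *.
(* Part [ord0] is kept for the powers of x; the successor shifts the residue of i modulo n to the
   parts 1, ..., n. *)
pose cl (g : gT) : 'I_n.+1 :=
  if [pick i : 'I_(2 * n) | g == x ^+ i * y]%g is Some i
  then inord (i %% n).+1 else ord0.
have cl_x i : cl (x ^+ i)%g = ord0.
  by rewrite /cl; case: pickP => // j; rewrite (negPf (xi_ne _ _)).
have mod2 i j : (i = j %[mod 2 * n] -> i = j %[mod n])%N.
  by move=> /(congr1 (modn^~ n)); rewrite !modn_dvdm ?dvdn_mull.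
have cl_xy i : cl (x ^+ i * y)%g = inord (i %% n).+1.
  rewrite /cl; case: pickP => [j|].
    by rewrite (inj_eq (mulIg y)) eqx => /eqP/mod2->.
  have i_lt : (i %% (2 * n) < 2 * n)%N by rewrite ltn_mod; lia.
  move/(_ (Ordinal i_lt)); rewrite (inj_eq (mulIg y)) eqx /= modn_mod.
  by rewrite eqxx.
have inord_eq i j :
    (inord (i %% n).+1 == inord (j %% n).+1 :> 'I_n.+1) = (i == j %[mod n]).
  by rewrite -val_eqE /= !inordK // ltnS ltn_pmod.
have inord_ne0 i : (inord (i %% n).+1 == ord0 :> 'I_n.+1) = false.
  by rewrite -val_eqE /= !inordK // ltnS ltn_pmod.
exists (fun u => cl (val u)); split; last first.
  move=> u v; rewrite /adj /= /nc_adj; congr negb; rewrite /=.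
  have [i [[-> ni]|->]] := noncentralP _ (valP u);
  have [j [[-> nj]|->]] := noncentralP _ (valP v); rewrite ?cl_x ?cl_xy.
  - by rewrite commX !eqxx.
  - by rewrite comm_xy (negPf ni) eq_sym inord_ne0.
  - by rewrite eq_sym comm_xy (negPf nj) inord_ne0.
  - by rewrite comm_yy inord_eq.
move=> a; rewrite (card_noncentral_set G (fun g => cl g == a)).
have xn_ne1 : (x ^+ n != 1)%g.
  by rewrite -(expg0 x) eqx mod0n modn_small; lia.
have [->|a0] := eqVneq a ord0.
  have -> : [set g in G :\: 'Z(G)%g | cl g == ord0] = (<[x]> :\: [set 1; x ^+ n])%g.
    apply/setP=> g; rewrite [LHS]inE [RHS]inE; apply/andP/andP.
      case=> /noncentralP[i [[-> ni] _|->]]; last by rewrite cl_xy inord_ne0.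
      rewrite mem_cycle !inE -(expg0 x) !eqx; split=> //.
      by apply: contra ni => /orP[]/eqP/mod2; rewrite /dvdn ?modnn => ->; rewrite ?mod0n.
    case=> nS /cycleP[i gE]; rewrite gE in nS *.
    rewrite in_setD memZ groupX // andbT cl_x.
    split=> //; apply: contra nS => /dvdnP[q ->]; rewrite in_set2 -(expg0 x) !eqx.
    rewrite (divn_eq q 2) mulnDl -mulnA !modnMDl modn2.
    by case: (odd q); rewrite ?mul1n ?mul0n eqxx ?orbT.
  rewrite cardsD (setIidPr _); last first.
    by apply/subsetP=> g /set2P[]->; rewrite ?group1 ?mem_cycle.
  rewrite -orderE ox cards2 eq_sym xn_ne1 /=; lia.
have a_gt0 : (0 < a)%N by rewrite lt0n -val_eqE in a0 *.
have a_lt : (a.-1 < n)%N by have := ltn_ord a; lia.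
have -> : [set g in G :\: 'Z(G)%g | cl g == a]
        = [set x ^+ a.-1 * y; x ^+ (a.-1 + n) * y]%g.
  have clE i : (cl (x ^+ i * y)%g == a) = (i == a.-1 %[mod n]).
    rewrite cl_xy -val_eqE /= inordK ?ltnS ?ltn_pmod // [X in _ = (_ == X)]modn_small //.
    by rewrite -{1}(prednK a_gt0) eqSS.
  apply/setP=> g; rewrite [LHS]inE in_set2; apply/andP/orP.
    case=> /noncentralP[i [[-> ni]|->]]; first by rewrite cl_x eq_sym (negPf a0).
    rewrite clE !(inj_eq (mulIg y)) !eqx => /eqP ia.
    (* A residue modulo n lifts to exactly two residues modulo 2n, so the part has two elements. *)
    have i2 : (i %% (2 * n) = a.-1 \/ i %% (2 * n) = a.-1 + n)%N.
      have : (i %% (2 * n) < 2 * n)%N by rewrite ltn_mod; lia.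
      have : (i %% (2 * n) %% n = a.-1)%N.
        by rewrite modn_dvdm ?dvdn_mull // ia modn_small.
      move: (i %% (2 * n))%N => j ja j_lt; have [jn|nj] := ltnP j n.
        by left; rewrite -ja modn_small.
      right; rewrite -(subnK nj) modnDr modn_small in ja; last by lia.
      by rewrite -ja subnK.
    by rewrite (@modn_small a.-1) ?(@modn_small (a.-1 + n)); lia.
  have Gxy i : (x ^+ i * y)%g \in G :\: 'Z(G)%g by rewrite in_setD NmemZ groupM ?groupX.
  by case=> /eqP->; rewrite Gxy clE ?modnDr.
rewrite cards2 (inj_eq (mulIg y)) expgD -{1}[(x ^+ a.-1)%g]mulg1.
by rewrite (inj_eq (mulgI _)) eq_sym xn_ne1.
Qed.

Theorem theorem2p14 (C : numClosedFieldType) (n : nat) (n_ge2 : (2 <= n)%N)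
    (gT : finGroupType) (G : {group gT}) (dicG : dicyclic n G) :
  let Gamma := noncommuting_graph G in
  let E := energy C Gamma in
  let LE := laplacian_energy C Gamma in
  let LEp := signless_laplacian_energy C Gamma in
  [/\ (* a *)
      [/\ E <= LEp, LEp <= LE, E = LEp <-> n = 2%N & LEp = LE <-> n = 2%N],
      (* b *)
      ~ hypoenergetic C Gamma /\ ~ hyperenergetic C Gamma
    & (* c *)
      (n = 2%N -> ~ L_hyperenergetic C Gamma /\ ~ Q_hyperenergetic C Gamma) /\
      (n <> 2%N -> Q_hyperenergetic C Gamma /\ L_hyperenergetic C Gamma)].
Proof.
move=> Gamma E LE LEp.
have [c gm] : exists c, multipartite (2 * n.-1) n 2 Gamma c.
  exact: dicyclic_multipartite.
(* From here on only the multipartite structure matters, and the group is forgotten. *)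
move: Gamma @E @LE @LEp c gm {dicG} => Gamma E LE LEp c gm.
have [k nE] : exists k, n = k.+2 by exists n.-2; lia.
subst n; rewrite /= in gm.
have cardG : #|Gamma| = (4 * k + 5).+1 by rewrite (card_multipartite _ _ _ _ _ gm); lia.
have q0 : (0 < 4 * k + 5)%N by lia.
rewrite /hypoenergetic /hyperenergetic /L_hyperenergetic /Q_hyperenergetic.
rewrite -/E -/LE -/LEp [X in complete_graph X]cardG (energy_complete _ q0).
rewrite (laplacian_energy_complete _ q0) (signless_laplacian_energy_complete _ q0).
have not_gt (u v : C) : u <= v -> ~ v < u by move=> uv /(le_lt_trans uv); rewrite ltxx.
have partb : ~ E < #|Gamma|%:R /\ ~ (2 * (4 * k + 5))%:R < E.
  split; [exact: not_gt _ _ (energy_ge_card _ _ _ gm)|].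
  exact: not_gt _ _ (energy_le_complete _ _ _ gm).
(* For k = 0 all the energies are 8, as is that of the complete graph on 6 vertices replaced by 10.
   For k > 0 the strict inequalities refute both equalities. *)
have [k0|k_gt0] := posnP k.
  subst k; have [E8 LEp8 LE8] := energies_Q8 (C := C) _ _ gm.
  rewrite -/E -/LE -/LEp in E8 LEp8 LE8; rewrite E8 LEp8 LE8 in partb *.
  split=> //; split=> // _.
  by split; apply: not_gt; rewrite ler_nat.
have EQ : E < LEp := energy_lt_signless _ _ _ k_gt0 gm.
have QL : LEp < LE := signless_lt_laplacian _ _ _ k_gt0 gm.
have QK : _ < LEp := signless_gt_complete _ _ _ k_gt0 gm.
have n_ne2 : k.+2 <> 2%N by lia.
split; [|exact: partb|split=> [/n_ne2//|_]]; last first.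
  by split; [exact: QK | exact: lt_trans QK QL].
have [nEQ nQL] := (ltW EQ, ltW QL).
split; [exact: nEQ | exact: nQL | split=> [eqE|/n_ne2//] | split=> [eqE|/n_ne2//]].
  by rewrite eqE ltxx in EQ.
by rewrite eqE ltxx in QL.
Qed.
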